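(* Let $\mathbf A\in\mathbb R^{n\times n}$. The following are equivalent: (1) $\mathbf A$ has the signature equality property; (2) $\mathbf A$ is eventually SJS, i.e. there is a positive integer $k_0$ such that $\mathbf A^k$ is SJS for all $k\ge k_0$; (3) there is a positive integer $k$ such that both $\mathbf A^k$ and $\mathbf A^{k+1}$ are SJS.
   Context: For $J\subseteq[n]=\{1,\dots,n\}$ with $J^c=[n]\setminus J$, a real matrix $\mathbf B=\{b_{ij}\}$ is strictly $J$-sign-symmetric if $b_{ij}>0$ for $(i,j)\in (J\times J)\cup(J^c\times J^c)$ and $b_{ij}<0$ for $(i,j)\in(J\times J^c)\cup(J^c\times J)$; $\mathbf B$ is SJS if it is strictly $J$-sign-symmetric for some $J\subseteq[n]$. An eigenfunctional of $\mathbf A$ for eigenvalue $\lambda$ is an eigenvector of $\mathbf A^T$ for $\lambda$. For $x\in\mathbb R^n$, $\mathrm{Sign}(x)=(\mathrm{sgn}(x^1),\dots,\mathrm{sgn}(x^n))^T$. $\mathbf A$ has the signature equality property if (i) $\mathbf A$ has a simple positive eigenvalue $\lambda>0$ with $\lambda>|\mu|$ for every other eigenvalue $\mu$ of $\mathbf A$, and (ii) the corresponding eigenvector $x$ and eigenfunctional $x^*$ have no zero coordinates and can be chosen with $\mathrm{Sign}(x)=\mathrm{Sign}(x^* )$. *)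

(* Defs.v *)
From HB Require Import structures.
From mathcomp Require Import all_boot all_order all_algebra.
From mathcomp Require Import reals.
From mathcomp.real_closed Require Import complex.
Set Implicit Arguments. Unset Strict Implicit. Unset Printing Implicit Defensive.
Import Order.TTheory GRing.Theory Num.Theory.
Local Open Scope ring_scope.
Local Open Scope complex_scope.

Definition strictly_J_sign_symmetric (R : realType) (n : nat)
  (J : {set 'I_n}) (B : 'M[R]_n) : Prop :=
  forall i j : 'I_n,
    if (i \in J) == (j \in J) then 0 < B i j else B i j < 0.

Definition SJS (R : realType) (n : nat) (B : 'M[R]_n) : Prop :=
  exists J : {set 'I_n}, strictly_J_sign_symmetric J B.

Definition cmx (R : realType) (n : nat) (A : 'M[R]_n) : 'M[R[i]]_n :=
  map_mx (fun x : R => x%:C) A.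

Definition ceigenvalue (R : realType) (n : nat) (A : 'M[R]_n) (mu : R[i]) : Prop :=
  root (char_poly (cmx A)) mu.

Definition simple_eigenvalue (R : realType) (n : nat) (A : 'M[R]_n) (lam : R) : Prop :=
  root (char_poly A) lam /\ ~~ ((('X - lam%:P) ^+ 2) %| char_poly A).

Definition signature_equality (R : realType) (n : nat) (A : 'M[R]_n) : Prop :=
  exists lam : R,
    [/\ 0 < lam,
        simple_eigenvalue A lam,
        (forall mu : R[i], ceigenvalue A mu -> mu != lam%:C -> `|mu| < lam%:C) &
        exists (x y : 'cV[R]_n),
          [/\ A *m x = lam *: x,
              A^T *m y = lam *: y,
              (forall i, x i 0 != 0),
              (forall i, y i 0 != 0) &
              (forall i, Num.sg (x i 0) = Num.sg (y i 0))]].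

(* Main.v *)
Require Import Defs.
From HB Require Import structures.
From mathcomp Require Import all_boot all_order all_algebra.
From mathcomp Require Import reals.
From mathcomp.real_closed Require Import complex.
Import Order.TTheory GRing.Theory Num.Theory.
Local Open Scope ring_scope.

(** (1) => (2): normalise [y x = 1] and put [N = A - lam x y].  Then
    [A^k = lam^k x y + N^k], and ['X * chi_A = ('X - lam) * chi_N] shows that
    the eigenvalues of [N] have modulus less than [lam], so [N^k = o(lam^k)] and
    [A^k] eventually has the sign pattern of [x y].

    (3) => (1): a diagonal signature similarity makes [A^k] positive, and
    Perron's theorem gives its eigenvectors [x], [y] with equal signs.  As [A]
    commutes with [A^k] and the Perron eigenspaces are lines, [x] and [y] are
    eigenvectors of [A] for a common strictly dominant [lam]; the Perron root of
    [A^(k+1)] is then [lam^(k+1)], which forces [lam > 0].  The factorisation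
    above shows that [lam] is simple. *)

(** * Geometric growth of scalars and of matrix powers *)

Lemma bernoulli_ineq (R : numDomainType) (h : R) (k : nat) :
  0 <= h -> 1 + h *+ k <= (1 + h) ^+ k.
Proof.
move=> h0; elim: k => [|k IHk]; first by rewrite mulr0n addr0 expr0.
have h1 : 0 <= 1 + h by rewrite addr_ge0.
apply: le_trans (_ : (1 + h) * (1 + h *+ k) <= _).
  rewrite mulrDl mul1r mulrDr mulr1 mulrS [h + h *+ k]addrC.
  rewrite !addrA lerDl.
  by rewrite mulr_ge0 // mulrn_wge0.
by rewrite exprS ler_wpM2l.
Qed.

(** Writing [s = (1 + h) * r] with [h > 0], Bernoulli's inequality makes [(1 + h) ^+ k] outgrow the
    constant [c]. *)
Lemma expr_eventually_lt (R : realType) (c r s : R) : 0 <= r -> r < s ->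
  exists k0 : nat, forall k : nat, (k0 <= k)%N -> c * r ^+ k < s ^+ k.
Proof.
move=> r0 rs; have s0 := le_lt_trans r0 rs.
have [rE | rN0] := eqVneq r 0.
  (* The threshold is 1 and not 0 because [0 ^+ 0 = 1]. *)
  exists 1%N => k k0.
  by rewrite rE expr0n gtn_eqF // mulr0 exprn_gt0.
have rp : 0 < r by rewrite lt_def rN0.
pose h := s / r - 1.
have hp : 0 < h by rewrite /h subr_gt0 ltr_pdivlMr // mul1r.
have -> : s = (1 + h) * r by rewrite /h [1 + _]addrC subrK divfK.
have ch0 : 0 <= `|c| / h by rewrite divr_ge0 // ltW.
exists (Num.Def.archi_bound (`|c| / h)) => k kle.
rewrite exprMn ltr_pM2r ?exprn_gt0 //.
apply: lt_le_trans (bernoulli_ineq _ _ k (ltW hp)).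
apply: le_lt_trans (ler_norm c) _.
have := lt_le_trans (archi_boundP ch0) (_ : _ <= k%:R).
rewrite ler_nat => /(_ kle); rewrite ltr_pdivrMr // mulr_natl => lt1.
by apply: lt_le_trans lt1 _; rewrite lerDr.
Qed.

(* If [u_(k+1) = mu u_k + w_k] with [|mu| < r] and [w = O(r^k)], then
   [u = O(r^k)]: peel off the roots of the annihilating polynomial one by one. *)
Lemma mx_pow_bound_annihilated (F : numFieldType) (n : nat) (N : 'M[F]_n.+1)
    (r : F) (s : seq F) (G : 'M[F]_n.+1) :
  {in s, forall mu : F, `|mu| < r} ->
  horner_mx N (\prod_(mu <- s) ('X - mu%:P)) * G = 0 ->
  exists2 c : F, 0 <= c & forall k i j, `|(N ^+ k * G) i j| <= c * r ^+ k.
Proof.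
elim: s G => [|mu s IHs] G hs.
  rewrite big_nil rmorph1 mul1r => ->.
  by exists 0 => // k i j; rewrite mulr0 mxE normr0 mul0r.
rewrite big_cons mulrC rmorphM /= -mulrA.
rewrite [horner_mx N ('X - _)]rmorphB /= horner_mx_X horner_mx_C => hG.
have [|c c0 hc] := IHs _ _ hG; first by move=> x xs; apply: hs; rewrite inE xs orbT.
have mur : `|mu| < r by apply: hs; rewrite mem_head.
have dp : 0 < r - `|mu| by rewrite subr_gt0.
have r0 : 0 <= r by apply: le_trans (ltW mur).
(* The induction step needs [c <= c' * (r - |mu|)], which the first summand ensures; the second
   covers [k = 0]. *)
pose c' := c / (r - `|mu|) + \sum_i \sum_j `|G i j|.
have S0 : 0 <= \sum_i \sum_j `|G i j| by do 2!apply: sumr_ge0 => ? _.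
have cd : 0 <= c / (r - `|mu|) by rewrite divr_ge0 // ltW.
have c'0 : 0 <= c' by rewrite addr_ge0.
exists c' => // k i j.
elim: k => [|k IHk].
  rewrite !expr0 mul1r mulr1 /c' (bigD1 i) //= (bigD1 j) //=.
  rewrite addrCA -addrA lerDl !addr_ge0 //; first exact: sumr_ge0.
  by do 2!apply: sumr_ge0 => ? _.
have -> : (N ^+ k.+1 * G) i j = (N ^+ k * ((N - mu%:M) * G)) i j + mu * (N ^+ k * G) i j.
  have -> : N ^+ k * ((N - mu%:M) * G) = N ^+ k.+1 * G - mu *: (N ^+ k * G).
    rewrite mulrBl mulrBr mulrA -exprSr; congr (_ - _).
    rewrite -[mu%:M * G]/(mu%:M *m G) mul_scalar_mx.
    by rewrite -[LHS]/(N ^+ k *m (mu *: G)) -scalemxAr.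
  by rewrite !mxE subrK.
apply: le_trans (ler_normD _ _) _; rewrite normrM.
apply: le_trans (lerD (hc k i j) (ler_wpM2l (normr_ge0 _) IHk)) _.
rewrite exprS !mulrA -mulrDl ler_wpM2r ?exprn_ge0 //.
rewrite -lerBrDr [`|mu| * _]mulrC -mulrBr /c' mulrDl divfK ?gt_eqF //.
by rewrite lerDl mulr_ge0 // ltW.
Qed.

(** By Cayley-Hamilton the split characteristic polynomial annihilates [N], so the roots can be
    peeled off with [G = 1]; no Jordan form is involved. *)
Lemma mx_pow_bound (F : numClosedFieldType) (n : nat) (N : 'M[F]_n.+1) (r : F) :
  (forall mu : F, root (char_poly N) mu -> `|mu| < r) ->
  exists2 c : F, 0 <= c & forall k i j, `|(N ^+ k) i j| <= c * r ^+ k.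
Proof.
move=> hr; have [s hs] := closed_field_poly_normal (char_poly N).
rewrite (monicP (char_poly_monic N)) scale1r in hs.
have [|| c c0 hc] := @mx_pow_bound_annihilated _ _ N r s 1.
- by move=> mu mus; apply: hr; rewrite hs root_prod_XsubC.
- by rewrite -hs Cayley_Hamilton mul0r.
by exists c => // k i j; have := hc k i j; rewrite mulr1.
Qed.

(** * Rank-one deflation of the characteristic polynomial *)

(** Both sides compute [a * \det M] for the bordered matrix [M], eliminating one diagonal block or
    the other. Keeping the factor [a] avoids dividing by it, so that [a] may be ['X]. *)
Lemma det_sub_rank1 (R : idomainType) (n : nat) (u : 'cV[R]_n) (v : 'rV[R]_n) (a : R) :
  a * \det (a%:M - u *m v) = (a - (v *m u) 0 0) * a ^+ n.
Proof.
pose M : 'M[R]_(1 + n) := block_mx 1%:M v u a%:M.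
have d1 : \det M = \det (a%:M - u *m v).
  have -> : M = block_mx 1%:M 0 u 1%:M *m block_mx 1%:M v 0 (a%:M - u *m v).
    rewrite mulmx_block !mul1mx !mul0mx ?mulmx1 !addr0.
    by rewrite addrC subrK.
  by rewrite det_mulmx det_lblock det_ublock !det1 !mul1r.
have d2 : M *m block_mx a%:M 0 (- u) 1%:M = block_mx (a%:M - v *m u) v 0 a%:M.
  rewrite mulmx_block !mul1mx !mulmx0 !mulmx1 !add0r mulmxN.
  by rewrite mul_mx_scalar mulmxN mul_scalar_mx subrr.
have := congr1 determinant d2.
rewrite det_mulmx det_lblock det_ublock d1 !det_scalar1 det1 mulr1 det_scalar.
by rewrite det_mx11 !mxE eqxx mulr1n mulrC.
Qed.

(** As [N x = 0], the cross term vanishes in [('X - N) ('X - lam x y) = 'X ('X - A)]. Take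
    determinants, evaluate the rank-one factor, and cancel ['X ^+ n]. *)
Lemma char_poly_deflation (F : fieldType) (n : nat) (A : 'M[F]_n)
    (x : 'cV[F]_n) (y : 'rV[F]_n) (lam : F) :
  A *m x = lam *: x -> (y *m x) 0 0 = 1 ->
  'X * char_poly A = ('X - lam%:P) * char_poly (A - lam *: (x *m y)).
Proof.
move=> Ax yx; set N := A - _.
pose xp := map_mx (@polyC F) (lam *: x); pose yp := map_mx (@polyC F) y.
have Nx : N *m x = 0.
  rewrite mulmxBl Ax -scalemxAl -mulmxA [y *m x]mx11_scalar yx mulmx1.
  by rewrite subrr.
have fact : 'X%:M *m char_poly_mx A = char_poly_mx N *m ('X%:M - xp *m yp).
  rewrite /char_poly_mx mulmxBl !mulmxBr.
  have -> : map_mx polyC N *m (xp *m yp) = 0.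
    by rewrite mulmxA -map_mxM -scalemxAr Nx scaler0 map_mx0 mul0mx.
  rewrite subr0 -addrA; congr (_ + _).
  rewrite mul_mx_scalar !mul_scalar_mx -opprD -scalerDr; congr (- (_ *: _)).
  by rewrite -map_mxM -scalemxAl /N map_mxB addrC subrK.
have := congr1 determinant fact; rewrite !det_mulmx det_scalar.
rewrite -!/(char_poly _) => e1.
have e2 := det_sub_rank1 _ _ xp yp 'X.
have yxp : (yp *m xp) 0 0 = lam%:P.
  by rewrite -map_mxM mxE -scalemxAr mxE yx mulr1.
rewrite yxp in e2.
have XN0 : ('X : {poly F}) ^+ n != 0 by rewrite expf_neq0 ?polyX_eq0.
apply: (mulfI XN0); rewrite mulrCA e1 mulrCA e2.
by rewrite [LHS]mulrC mulrAC [RHS]mulrC.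
Qed.

(** * Complex comparison tools and Perron's theorem for positive matrices *)

(** The order of [R[i]] relates only numbers with equal imaginary parts, so [c], [r] and [s] are
    real and the real statement transfers. *)
Lemma expr_eventually_ltC (R : realType) (c r s : R[i]%C) :
  0 <= c -> 0 <= r -> r < s ->
  exists k0 : nat, forall k : nat, (k0 <= k)%N -> c * r ^+ k < s ^+ k.
Proof.
move=> c0 r0 rs; have s0 := ltW (le_lt_trans r0 rs).
move: (c0) (r0) (rs).
rewrite -(RRe_real (ger0_real c0)) -(RRe_real (ger0_real r0)).
rewrite -(RRe_real (ger0_real s0)) => _.
rewrite ler0c ltcR => {}r0 {}rs.
have [k0 hk0] := expr_eventually_lt _ (complex.Re c) _ _ r0 rs.
by exists k0 => k /hk0; rewrite -!rmorphXn -rmorphM ltcR.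
Qed.

Lemma max_modulus_root (F : numClosedFieldType) (p : {poly F}) : (1 < size p)%N ->
  exists2 mu : F, root p mu & forall nu : F, root p nu -> `|nu| <= `|mu|.
Proof.
move=> sp; have p0 : p != 0 by rewrite -size_poly_gt0 ltnW.
have [s ps] := closed_field_poly_normal p.
have rE nu : root p nu = (nu \in s).
  by rewrite {1}ps rootZ ?lead_coef_eq0 // root_prod_XsubC.
have s0 : s != [::].
  apply: contraTneq sp => sE; rewrite ps sE big_nil size_scale ?lead_coef_eq0 //.
  by rewrite size_poly1.
have [mu mus hmu] : exists2 mu, mu \in s & {in s, forall nu, `|nu| <= `|mu|}.
  elim: s s0 {ps rE} => // a [|b s] IHs _.
    by exists a; rewrite ?mem_head // => x; rewrite inE => /eqP ->.
  have [//|mu mus hmu] := IHs.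
  have [ha|/ltW ha] := real_leP (normr_real a) (normr_real mu).
    exists mu; first by rewrite inE mus orbT.
    by move=> x; rewrite inE => /orP[/eqP ->|/hmu].
  exists a; first by rewrite mem_head.
  move=> x; rewrite inE => /orP[/eqP -> //|/hmu hx]; exact: le_trans ha.
by exists mu; rewrite ?rE // => nu; rewrite rE => /hmu.
Qed.

(** The source of strictness in Perron's theorem: it makes a nonzero nonnegative defect strictly
    positive, and excludes zero coordinates of nonnegative eigenvectors. *)
Lemma mulmx_pos_gt0 (F : numDomainType) (n p : nat) (z : 'rV[F]_n) (P : 'M[F]_(n, p)) :
  (forall i j, 0 < P i j) -> (forall i, 0 <= z 0 i) -> z != 0 ->
  forall j, 0 < (z *m P) 0 j.
Proof.
move=> hP hz zN0 j.
have [i zi] : exists i, z 0 i != 0.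
  apply/existsP; apply: contraNT zN0 => /existsPn h.
  by apply/eqP/rowP => i; rewrite mxE; apply/eqP; move: (h i); rewrite negbK.
rewrite mxE (bigD1 i) //= ltr_pwDl //.
  by rewrite mulr_gt0 // lt_def zi hz.
by apply: sumr_ge0 => k _; rewrite mulr_ge0 // ltW.
Qed.

Lemma norm_mx_eq0 (F : numDomainType) (n : nat) (v : 'rV[F]_n) :
  (map_mx Num.norm v == 0) = (v == 0).
Proof.
apply/eqP/eqP => [/rowP h|->]; apply/rowP => i.
  by move: (h i); rewrite !mxE => /eqP; rewrite normr_eq0 => /eqP.
by rewrite !mxE normr0.
Qed.

Lemma norm_eigen_le (F : numDomainType) (n : nat) (v : 'rV[F]_n) (P : 'M[F]_n) (mu : F) :
  (forall i j, 0 < P i j) -> v *m P = mu *: v ->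
  forall j, `|mu| * `|v 0 j| <= (map_mx Num.norm v *m P) 0 j.
Proof.
move=> hP vP j; move/rowP/(_ j): vP; rewrite !mxE -normrM => <-.
apply: le_trans (ler_norm_sum _ _ _) _; apply: ler_sum => i _.
by rewrite mxE normrM [`|P i j|]ger0_norm // ltW.
Qed.

Lemma mulmx_pow_ge (F : numDomainType) (n : nat) (w : 'rV[F]_n) (P : 'M[F]_n) (r : F) :
  (forall i j, 0 < P i j) -> 0 <= r ->
  (forall j, r * w 0 j <= (w *m P) 0 j) ->
  forall k j, r ^+ k * w 0 j <= (w *m P ^+ k) 0 j.
Proof.
move=> hP r0 hw; elim=> [|k IHk] j; first by rewrite !expr0 mul1r mulmx1.
rewrite [P ^+ k.+1]exprSr [w *m _]mulmxA exprSr -mulrA.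
apply: le_trans (ler_wpM2l (exprn_ge0 k r0) (hw j)) _.
rewrite [X in _ <= X]mxE [X in _ * X]mxE mulr_sumr; apply: ler_sum => i _.
by rewrite mulrA ler_wpM2r // ltW.
Qed.

(* For a root [mu] of maximal modulus with eigenvector [v], if [|v| P] were
   not equal to [|mu| |v|], then [w = |v| P] would satisfy [w P >= (|mu| + e) w]
   with [e > 0], contradicting [P ^+ k = O((|mu| + e / 2) ^+ k)]. *)
Lemma perron_left_exists (R : realType) (n : nat) (P : 'M[R[i]%C]_n.+1) :
  (forall i j, 0 < P i j) ->
  exists rho : R[i]%C, exists2 y : 'rV[R[i]%C]_n.+1,
    0 < rho /\ (forall i, 0 < y 0 i) & y *m P = rho *: y.
Proof.
move=> hP.
have [|mu rmu hmax] := max_modulus_root _ (char_poly P).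
  by rewrite size_char_poly.
move: (rmu); rewrite -eigenvalue_root_char => /eigenvalueP[v vP vN0].
pose z := map_mx Num.norm v; pose rho := `|mu|.
have zN0 : z != 0 by rewrite norm_mx_eq0.
have z0 i : 0 <= z 0 i by rewrite mxE.
have hz j : rho * z 0 j <= (z *m P) 0 j.
  by rewrite [z 0 j]mxE; apply: norm_eigen_le.
have zP := mulmx_pos_gt0 _ _ _ _ _ hP z0 zN0.
have rho0 : 0 <= rho by rewrite normr_ge0.
have [zE|zNE] := eqVneq (z *m P) (rho *: z); last first.
  exfalso; set w := z *m P in zNE zP hz.
  pose d := w - rho *: z.
  have dE i : d 0 i = w 0 i - rho * z 0 i by rewrite !mxE.
  have d0 i : 0 <= d 0 i by rewrite dE subr_ge0.
  have dN0 : d != 0 by rewrite subr_eq0.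
  have dP := mulmx_pos_gt0 _ _ _ _ _ hP d0 dN0.
  have dPE j : (d *m P) 0 j = (w *m P) 0 j - rho * w 0 j.
    by rewrite mulmxBl -scalemxAl -/w !mxE.
  (* [S] dominates every ratio [w_j / (d P)_j], so [S^-1] is a uniform gain:
     [S^-1 * w <= d P = w P - rho * w] entrywise. *)
  pose S := \sum_j w 0 j / (d *m P) 0 j.
  have hS j : w 0 j / (d *m P) 0 j <= S.
    by rewrite /S (bigD1 j) //= lerDl sumr_ge0 // => i _; rewrite divr_ge0 // ltW.
  have Sp : 0 < S by apply: lt_le_trans (hS 0); rewrite divr_gt0.
  pose s := rho + S^-1.
  have rs : rho < s by rewrite ltrDl invr_gt0.
  have hw j : s * w 0 j <= (w *m P) 0 j.
    rewrite mulrDl -lerBrDl -dPE mulrC ler_pdivrMr //.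
    by rewrite mulrC -ler_pdivrMr.
  have s0 : 0 <= s by apply: le_trans (ltW rs).
  pose r := (rho + s) / 2.
  have rhor : rho < r by rewrite midf_lt.
  have rlts : r < s by rewrite midf_lt.
  have r0 : 0 <= r by apply: le_trans (ltW rhor).
  have hr nu : root (char_poly P) nu -> `|nu| < r.
    by move=> /hmax hnu; apply: le_lt_trans rhor.
  have [c c0 hc] := mx_pow_bound _ _ _ _ hr.
  pose W := \sum_i w 0 i.
  have W0 : 0 <= W by apply: sumr_ge0 => i _; apply: ltW.
  (* Coordinate 0 of [w P ^+ k] is at least [s ^+ k * w 0 0] and at most [W * c * r ^+ k]; this
     constant makes the two bounds clash. *)
  have C0 : 0 <= W * c / w 0 0 by rewrite divr_ge0 ?mulr_ge0 // ltW.
  have [k0 /(_ k0 (leqnn _))] := expr_eventually_ltC _ _ _ _ C0 r0 rlts.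
  apply/negP; rewrite -real_leNgt ?ger0_real ?exprn_ge0 //; last first.
    by rewrite mulr_ge0 ?exprn_ge0.
  rewrite mulrAC ler_pdivlMr //.
  apply: le_trans (mulmx_pow_ge _ _ _ _ _ hP s0 hw k0 0) _.
  rewrite mxE -mulrA mulr_suml; apply: ler_sum => i _.
  rewrite ler_wpM2l ?(ltW (zP _)) //; apply: le_trans (hc k0 i 0).
  apply: real_ler_norm; apply: ger0_real.
  elim: (k0) (i) (0 : 'I_n.+1) => [|k IHk] a b; first by rewrite mxE ler0n.
  rewrite exprS -[P * _]/(P *m _) mxE; apply: sumr_ge0 => l _.
  by rewrite mulr_ge0 ?(ltW (hP _ _)).
exists rho, z => //.
have h i : 0 < rho * z 0 i by have := zP i; rewrite zE mxE.
have rhoN0 : rho != 0 by apply: contraTneq (h 0) => ->; rewrite mul0r ltxx.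
have rp : 0 < rho by rewrite lt_def rhoN0.
by split=> // i; have := h i; rewrite pmulr_rgt0.
Qed.

(** Pairing with a positive right eigenvector turns the entrywise inequality [a |v| <= |v| P] into
    the scalar one [a <= rho]; when [a = rho] the pairing is zero, so the nonnegative defect
    vanishes. *)
Lemma perron_defect (F : numDomainType) (n : nat) (P : 'M[F]_n) (x : 'cV[F]_n)
    (rho a : F) (z : 'rV[F]_n) : P *m x = rho *: x ->
  \sum_j ((z *m P) 0 j - a * z 0 j) * x j 0 = (rho - a) * \sum_j z 0 j * x j 0.
Proof.
move=> Px.
have e : z *m P *m x = rho *: (z *m x) by rewrite -mulmxA Px -scalemxAr.
move/matrixP/(_ 0 0): e; rewrite !mxE => e.
rewrite mulrBl -e mulr_sumr -sumrB; apply: eq_bigr => j _.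
by rewrite mulrBl mulrA.
Qed.

Lemma perron_norm_le (F : numFieldType) (n : nat) (P : 'M[F]_n) (x : 'cV[F]_n)
    (rho mu : F) (v : 'rV[F]_n) :
  (forall i j, 0 < P i j) -> (forall i, 0 < x i 0) -> P *m x = rho *: x ->
  v *m P = mu *: v -> v != 0 -> `|mu| <= rho.
Proof.
move=> hP hx Px vP vN0; pose z := map_mx Num.norm v.
have := perron_defect _ _ _ _ _ `|mu| z Px.
have sp : 0 < \sum_j z 0 j * x j 0.
  have z0 i : 0 <= z 0 i by rewrite mxE.
  have zN0 : z != 0 by rewrite norm_mx_eq0.
  have xp i j : 0 < x i j by rewrite ord1.
  by have := mulmx_pos_gt0 _ _ _ _ _ xp z0 zN0 0; rewrite mxE.
move=> e; rewrite -subr_ge0 -(pmulr_lge0 _ sp) -e.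
apply: sumr_ge0 => j _; rewrite mulr_ge0 ?(ltW (hx _)) // subr_ge0.
by rewrite [z 0 j]mxE; apply: norm_eigen_le.
Qed.

Lemma perron_norm_eq (F : numFieldType) (n : nat) (P : 'M[F]_n) (x : 'cV[F]_n)
    (rho mu : F) (v : 'rV[F]_n) :
  (forall i j, 0 < P i j) -> (forall i, 0 < x i 0) -> P *m x = rho *: x ->
  v *m P = mu *: v -> `|mu| = rho ->
  map_mx Num.norm v *m P = rho *: map_mx Num.norm v.
Proof.
move=> hP hx Px vP mur; set z := map_mx _ v.
have := perron_defect _ _ _ _ _ rho z Px; rewrite subrr mul0r => /eqP.
have d0 j : 0 <= (z *m P) 0 j - rho * z 0 j.
  by rewrite subr_ge0 -mur [z 0 j]mxE; apply: norm_eigen_le.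
rewrite psumr_eq0; last by move=> j _; rewrite mulr_ge0 // ltW.
move=> /allP h.
apply/rowP => j; have := h j; rewrite mem_index_enum => /(_ isT) /=.
by rewrite mulf_eq0 (gt_eqF (hx j)) orbF subr_eq0 => /eqP ->; rewrite [RHS]mxE.
Qed.

(** The triangle inequality is an equality in column 0, so all [v_i] share one phase and [mu] may be
    replaced by [rho]. A multiple of [y] is then subtracted to create a zero coordinate, which a
    nonzero Perron eigenvector cannot have. *)
Lemma perron_left_unique (F : numClosedFieldType) (n : nat) (P : 'M[F]_n.+1)
    (x : 'cV[F]_n.+1) (y : 'rV[F]_n.+1) (rho mu : F) (v : 'rV[F]_n.+1) :
  (forall i j, 0 < P i j) -> 0 < rho ->
  (forall i, 0 < x i 0) -> P *m x = rho *: x ->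
  (forall i, 0 < y 0 i) -> y *m P = rho *: y ->
  v *m P = mu *: v -> `|mu| = rho -> exists c : F, v = c *: y.
Proof.
move=> hP rp hx Px hy yP vP mur.
have [->|vN0] := eqVneq v 0; first by exists 0; rewrite scale0r.
have zP := perron_norm_eq _ _ _ _ _ _ _ hP hx Px vP mur.
set z := map_mx Num.norm v in zP.
have [t _ ht] : {t : F | `|t| == 1 & forall i, true -> v 0 i * P i 0 = `|v 0 i * P i 0| * t}.
  apply: normC_sum_eq.
  move/rowP/(_ 0): vP; rewrite !mxE => ->; rewrite normrM mur.
  move/rowP/(_ 0): zP; rewrite !mxE => <-; apply: eq_bigr => i _.
  by rewrite mxE normrM [`|P i 0|]ger0_norm // ltW.
have vz : v = t *: z.
  apply/rowP => i; have := ht i isT.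
  rewrite normrM [`|P i 0|]ger0_norm ?(ltW (hP _ _)) // mulrAC.
  by move/(mulIf (lt0r_neq0 (hP i 0))) => ->; rewrite !mxE mulrC.
have vP' : v *m P = rho *: v.
  by rewrite vz -scalemxAl zP scalerA mulrC -scalerA.
(* The coefficient is chosen so that [w 0 0 = 0]. *)
pose w := v - (v 0 0 / y 0 0) *: y.
have wP : w *m P = rho *: w.
  by rewrite mulmxBl vP' -scalemxAl yP scalerBr !scalerA [rho * _]mulrC.
exists (v 0 0 / y 0 0); apply/eqP; rewrite -subr_eq0 -/w.
apply/negPn/negP => wN0.
have nrho : `|rho| = rho by rewrite ger0_norm // ltW.
have wnP := perron_norm_eq _ _ _ _ _ _ _ hP hx Px wP nrho.
have := mulmx_pos_gt0 _ _ _ (map_mx Num.norm w) _ hP.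
rewrite norm_mx_eq0 => /(_ _ wN0 0); rewrite wnP => h.
suff : 0 < (rho *: map_mx Num.norm w) 0 0.
  by rewrite !mxE divfK ?subrr ?normr0 ?mulr0 ?ltxx // gt_eqF.
by apply: h => i; rewrite mxE.
Qed.

(** * Real matrices over the complex numbers, eigenvectors of powers, and signs *)

Lemma normc_real (R : realType) (x : R) : `|x%:C%C| = `|x|%:C%C :> R[i]%C.
Proof.
have [x0|x0] := leP 0 x; first by rewrite !ger0_norm ?ler0c.
have x1 : x%:C%C <= 0 :> R[i]%C by rewrite -[0]/(0%:C%C) lecR ltW.
by rewrite ler0_norm // ltr0_norm // rmorphN.
Qed.

Lemma cmxX (R : realType) (n : nat) (A : 'M[R]_n) (k : nat) :
  cmx (A ^+ k) = cmx A ^+ k.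
Proof.
elim: k => [|k IHk]; first by rewrite !expr0 /cmx (map_mx1 (real_complex R)).
by rewrite !exprS -IHk /cmx (map_mxM (real_complex R)).
Qed.

Lemma mulmx_pow_eigen (R : comNzRingType) (n : nat) (A : 'M[R]_n) (v : 'rV[R]_n) (a : R) (k : nat) :
  v *m A = a *: v -> v *m A ^+ k = a ^+ k *: v.
Proof.
move=> vA; elim: k => [|k IHk]; first by rewrite !expr0 mulmx1 scale1r.
by rewrite exprS [v *m _]mulmxA vA -scalemxAl IHk scalerA -exprS.
Qed.

Lemma same_sign_dot_gt0 (R : realDomainType) (n : nat) (x : 'cV[R]_n.+1) (y : 'rV[R]_n.+1) :
  (forall i, x i 0 != 0) -> (forall i, Num.sg (x i 0) = Num.sg (y 0 i)) ->
  0 < (y *m x) 0 0.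
Proof.
move=> hx hs.
have p i : 0 < y 0 i * x i 0.
  by rewrite -sgr_gt0 sgrM -hs -expr2 exprn_even_gt0 //= sgr_eq0.
by rewrite mxE big_ord_recl ltr_pwDl // sumr_ge0 // => i _; apply: ltW.
Qed.

Lemma sign_sym_pos (R : realType) (n : nat) (J : {set 'I_n}) (B : 'M[R]_n) :
  strictly_J_sign_symmetric J B ->
  forall i j, 0 < (-1) ^+ (i \notin J) * B i j * (-1) ^+ (j \notin J).
Proof.
move=> hB i j; have := hB i j.
by case: (i \in J); case: (j \in J);
  rewrite /= ?expr0 ?expr1 ?mul1r ?mulr1 ?mulN1r ?mulrN1 ?opprK ?oppr_gt0.
Qed.

(** * Perron data of an SJS matrix *)

(** Conjugation by the signature matrix [S] of [J] gives a positive matrix [P], and Perron's theorem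
    is applied to [P] and [P^T]. Dominance and uniqueness are stated over [R[i]] in order to control
    nonreal eigenvalues. *)
Lemma SJS_perron (R : realType) (n : nat) (B : 'M[R]_n.+1) : SJS B ->
  exists (rho : R) (x : 'cV[R]_n.+1) (y : 'rV[R]_n.+1),
  [/\ [/\ 0 < rho, B *m x = rho *: x & y *m B = rho *: y],
      forall i, [/\ x i 0 != 0, y 0 i != 0 & Num.sg (x i 0) = Num.sg (y 0 i)],
      forall (mu : R[i]%C) (v : 'rV[R[i]%C]_n.+1),
        v *m cmx B = mu *: v -> v != 0 -> `|mu| <= rho%:C%C,
      forall (mu : R[i]%C) (v : 'rV[R[i]%C]_n.+1),
        v *m cmx B = mu *: v -> `|mu| = rho%:C%C ->
        exists c : R[i]%C, v = c *: map_mx (real_complex R) y &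
      forall u : 'cV[R[i]%C]_n.+1, cmx B *m u = rho%:C%C *: u ->
        exists c : R[i]%C, u = c *: map_mx (real_complex R) x].
Proof.
move=> [J hJ].
pose s i : R := (-1) ^+ (i \notin J).
have ss i : s i * s i = 1 by rewrite /s -expr2 sqrr_sign.
pose S := map_mx (real_complex R) (diag_mx (\row_i s i)).
have SS : S *m S = 1%:M.
  rewrite /S -map_mxM mul_mx_diag -(map_mx1 (real_complex R)); congr map_mx.
  apply/matrixP => i j; rewrite !mxE.
  by have [->|_] := eqVneq i j; rewrite ?mulr1n ?ss // mulr0n mul0r.
pose P := S *m cmx B *m S.
have hP i j : 0 < P i j.
  rewrite /P /S /cmx -!(map_mxM (real_complex R)) mul_mx_diag mul_diag_mx !mxE.
  by rewrite -[0]/(0%:C%C) ltcR; apply: sign_sym_pos.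
have hPT i j : 0 < P^T i j by rewrite mxE.
have [rho [y' [rho0 y'p] y'P]] := perron_left_exists _ _ _ hP.
have [rho' [xT [_ xTp] xTP]] := perron_left_exists _ _ _ hPT.
pose x' := xT^T.
have x'p i : 0 < x' i 0 by rewrite mxE.
have yx0 : 0 < (y' *m x') 0 0.
  by rewrite mxE big_ord_recl ltr_pwDl ?mulr_gt0 // sumr_ge0 // => i _; rewrite ltW ?mulr_gt0.
have Px' : P *m x' = rho *: x'.
  (* [P] and [P^T] come with separate Perron roots; evaluating [y' P x'] in two ways identifies
     them, since [y' x' > 0]. *)
  have Px1 : P *m x' = rho' *: x'.
    by apply: trmx_inj; rewrite trmx_mul trmxK xTP linearZ /= trmxK.
  rewrite Px1; congr (_ *: _).
  have := mulmxA y' P x'; rewrite y'P Px1 -scalemxAl -scalemxAr.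
  move/matrixP/(_ 0 0); rewrite !mxE.
  have -> : \sum_j y' 0 j * x' j 0 = (y' *m x') 0 0 by rewrite mxE.
  by move/(mulIf (lt0r_neq0 yx0)).
have x'PT : x'^T *m P^T = rho *: x'^T by rewrite -trmx_mul Px' linearZ.
have PTy' : P^T *m y'^T = rho *: y'^T by rewrite -trmx_mul y'P linearZ.
pose r := complex.Re rho.
have rE : r%:C%C = rho by rewrite RRe_real // ger0_real // ltW.
(* Positive entries of [R[i]] are real, so [Re] loses nothing. The same sign [s i] multiplies both
   vectors, hence their signs agree. *)
pose y := \row_i (complex.Re (y' 0 i) * s i); pose x := \col_i (s i * complex.Re (x' i 0)).
have yE : map_mx (real_complex R) y = y' *m S.
  rewrite /S map_diag_mx mul_mx_diag; apply/rowP => i; rewrite !mxE rmorphM /=.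
  by rewrite RRe_real // ger0_real // ltW.
have xE : map_mx (real_complex R) x = S *m x'.
  rewrite /S map_diag_mx mul_diag_mx; apply/colP => i; rewrite !mxE rmorphM /=.
  by rewrite RRe_real // ger0_real // ltW // -[xT 0 i]mxE.
have BS : cmx B *m S = S *m P by rewrite /P !mulmxA SS mul1mx.
have SB : S *m cmx B = P *m S by rewrite /P -mulmxA SS mulmx1.
have reP (c : R[i]%C) : 0 < c -> 0 < complex.Re c.
  by move=> c0; rewrite -ltcR RRe_real // ger0_real // ltW.
have sN0 i : s i != 0 by rewrite signr_eq0.
have left_eig v mu : v *m cmx B = mu *: v -> (v *m S) *m P = mu *: (v *m S).
  by move=> h; rewrite /P !mulmxA -(mulmxA v) SS mulmx1 h -scalemxAl.
have SK m (v : 'M_(m, n.+1)) : v *m S *m S = v by rewrite -mulmxA SS mulmx1.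
exists r, x, y; split.
- split; first by apply: reP.
  + apply: (@map_mx_inj _ _ (real_complex R)).
    rewrite map_mxM map_mxZ /= rE xE -[map_mx _ B]/(cmx B).
    by rewrite mulmxA BS -mulmxA Px' scalemxAr.
  + apply: (@map_mx_inj _ _ (real_complex R)).
    rewrite map_mxM map_mxZ /= rE yE -[map_mx _ B]/(cmx B).
    by rewrite -mulmxA SB mulmxA y'P scalemxAl.
- move=> i; have xp := reP _ (x'p i); have yp := reP _ (y'p i).
  rewrite [x i 0]mxE [y 0 i]mxE !mulf_neq0 ?sN0 ?gt_eqF //; split=> //.
  by rewrite !sgrM (gtr0_sg xp) (gtr0_sg yp) mul1r mulr1.
- move=> mu v /left_eig h vN0; rewrite rE.
  apply: perron_norm_le hP x'p Px' h _.
  by apply: contraNneq vN0 => h0; rewrite -(SK _ v) h0 mul0mx.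
- move=> mu v /left_eig h; rewrite rE => hmu.
  have [c hc] := perron_left_unique _ _ _ _ _ _ _ _ hP rho0 x'p Px' y'p y'P h hmu.
  by exists c; rewrite yE scalemxAl -hc SK.
- move=> u hu.
  (* Uniqueness on the right is uniqueness on the left for [P^T], where [x'] and [y'] exchange
     roles. *)
  have h : (S *m u)^T *m P^T = rho *: (S *m u)^T.
    rewrite -trmx_mul -linearZ /=; congr trmx.
    by rewrite -rE /P -!mulmxA (mulmxA S S) SS mul1mx hu -scalemxAr.
  have y'Tp i : 0 < y'^T i 0 by rewrite mxE.
  have x'Tp i : 0 < x'^T 0 i by rewrite mxE.
  have nrho : `|rho| = rho by rewrite ger0_norm // ltW.
  have [c hc] := perron_left_unique _ _ _ _ _ _ _ _ hPT rho0 y'Tp PTy' x'Tp x'PT h nrho.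
  exists c; rewrite xE scalemxAr -[c *: x']trmxK linearZ /= -hc trmxK.
  by rewrite mulmxA SS mul1mx.
Qed.

(** At a nonzero entry of [x], the factor [c] is a quotient of two real numbers. *)
Lemma real_scale_factor (R : realType) (m n : nat) (u x : 'M[R]_(m, n)) (c : R[i]%C)
    (i : 'I_m) (j : 'I_n) : x i j != 0 ->
  map_mx (real_complex R) u = c *: map_mx (real_complex R) x ->
  exists lam : R, u = lam *: x.
Proof.
move=> xN0 h; exists (u i j / x i j).
apply: (@map_mx_inj _ _ (real_complex R)); rewrite map_mxZ h; congr (_ *: _).
move/matrixP/(_ i j): h; rewrite !mxE => h.
by rewrite fmorph_div /= h mulfK // -[0]/(0%:C%C) (inj_eq (@complexI R)).
Qed.

(** * From two consecutive SJS powers to the signature equality property *)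

Lemma commuting_left_eigenvector (R : realType) (n : nat) (A B : 'M[R]_n.+1) (rho : R)
    (y : 'rV[R]_n.+1) : A *m B = B *m A -> 0 < rho -> y 0 0 != 0 ->
  y *m B = rho *: y ->
  (forall (mu : R[i]%C) (v : 'rV[R[i]%C]_n.+1),
    v *m cmx B = mu *: v -> `|mu| = rho%:C%C ->
    exists c : R[i]%C, v = c *: map_mx (real_complex R) y) ->
  exists lam : R, y *m A = lam *: y.
Proof.
move=> AB rho0 y0 yB uniq.
have e : map_mx (real_complex R) (y *m A) *m cmx B
         = rho%:C%C *: map_mx (real_complex R) (y *m A).
  by rewrite -map_mxM -mulmxA AB mulmxA yB -scalemxAl map_mxZ.
have [|c hc] := uniq _ _ e; first by rewrite normc_real gtr0_norm.
exact: real_scale_factor y0 hc.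
Qed.

Lemma SJS_pow_signature_equality (R : realType) (n k : nat) (A : 'M[R]_n.+1) :
  (0 < k)%N -> SJS (A ^+ k) -> SJS (A ^+ k.+1) -> signature_equality A.
Proof.
move=> k0 /SJS_perron[rho [x [y [[rho0 Bx yB] hxy leB uniqB uniqBr]]]].
move=> /SJS_perron[rho2 [x2 [y2 [[rho20 _ y2C] hxy2 leC uniqC _]]]].
have y0 : y 0 0 != 0 by case: (hxy 0).
have x0 : x 0 0 != 0 by case: (hxy 0).
have y20 : y2 0 0 != 0 by case: (hxy2 0).
have AB : A *m A ^+ k = A ^+ k *m A by rewrite -[LHS]/(A * _) -exprS exprSr.
have AC : A *m A ^+ k.+1 = A ^+ k.+1 *m A by rewrite -[LHS]/(A * _) -exprS exprSr.
have [lam yA] := commuting_left_eigenvector _ _ _ _ _ _ AB rho0 y0 yB uniqB.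
have [lam2 y2A] := commuting_left_eigenvector _ _ _ _ _ _ AC rho20 y20 y2C uniqC.
have yxp : 0 < (y *m x) 0 0 by apply: same_sign_dot_gt0 => i; case: (hxy i).
have Ax : A *m x = lam *: x.
  have e : cmx (A ^+ k) *m map_mx (real_complex R) (A *m x)
           = rho%:C%C *: map_mx (real_complex R) (A *m x).
    by rewrite -map_mxM mulmxA -AB -mulmxA Bx -scalemxAr map_mxZ.
  have [c hc] := uniqBr _ e.
  have [a ha] := real_scale_factor _ _ _ _ _ _ _ _ x0 hc.
  rewrite ha; congr (_ *: _).
  (* Evaluating [y A x] in two ways shows that [x] has the same eigenvalue [lam] as [y]. *)
  have := mulmxA y A x; rewrite ha yA -scalemxAl -scalemxAr.
  move/matrixP/(_ 0 0); rewrite [LHS]mxE [RHS]mxE.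
  by move/(mulIf (lt0r_neq0 yxp)).
have scal_inj (a b : R) (v : 'rV[R]_n.+1) : v 0 0 != 0 -> a *: v = b *: v -> a = b.
  by move=> v0 /rowP/(_ 0); rewrite !mxE => /(mulIf v0).
have lamk : lam ^+ k = rho.
  by apply: (scal_inj _ _ y) => //; rewrite -yB (mulmx_pow_eigen _ _ _ _ _ k yA).
have lam2k : lam2 ^+ k.+1 = rho2.
  by apply: (scal_inj _ _ y2) => //; rewrite -y2C (mulmx_pow_eigen _ _ _ _ _ k.+1 y2A).
have cN0 (v : 'rV[R]_n.+1) : v 0 0 != 0 -> map_mx (real_complex R) v != 0.
  by move=> v0; rewrite (map_mx_eq0 (real_complex R)); apply: contraNneq v0 => ->; rewrite mxE.
have cE (v : 'rV[R]_n.+1) a l : v *m A = a *: v ->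
    map_mx (real_complex R) v *m cmx (A ^+ l) = (a ^+ l)%:C%C *: map_mx (real_complex R) v.
  by move=> h; rewrite -map_mxM (mulmx_pow_eigen _ _ _ _ _ l h) map_mxZ.
have k1 : (0 < k.+1)%N by [].
have nrho : `|rho| = rho by apply: gtr0_norm.
have nrho2 : `|rho2| = rho2 by apply: gtr0_norm.
(* Each Perron vector is tested against the dominance of the other power. Equal moduli then let
   uniqueness for [A ^+ k] make [y2] a multiple of [y]. *)
have le1 : `|lam| <= `|lam2|.
  have := leC _ _ (cE _ _ k.+1 yA) (cN0 _ y0).
  rewrite normc_real lecR -nrho2 -lam2k !normrX.
  by rewrite ler_pXn2r // nnegrE.
have le2 : `|lam2| <= `|lam|.
  have := leB _ _ (cE _ _ k y2A) (cN0 _ y20).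
  rewrite normc_real lecR -nrho -lamk !normrX.
  by rewrite ler_pXn2r // nnegrE.
have [|c hc] := uniqB _ _ (cE _ _ k y2A).
  rewrite normc_real normrX -nrho -lamk normrX; congr ((_ ^+ _)%:C%C).
  by apply/le_anti; rewrite le2 le1.
have [a y2E] := real_scale_factor _ _ _ _ _ _ _ _ y0 hc.
have lamE : lam2 = lam.
  apply: (scal_inj _ _ y2) => //.
  by rewrite -y2A y2E -scalemxAl yA !scalerA mulrC.
(* Here consecutive exponents matter: [lam * rho = rho2] with both Perron roots positive, while an
   even [k] alone would not determine the sign of [lam]. *)
have lam0 : 0 < lam.
  have := rho20; rewrite -lam2k lamE exprS lamk.
  by rewrite pmulr_lgt0.
have dom (mu : R[i]%C) (v : 'rV[R[i]%C]_n.+1) :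
    v *m cmx A = mu *: v -> v != 0 -> mu != lam%:C%C -> `|mu| < lam%:C%C.
  move=> vA vN0 muN.
  have vB : v *m cmx (A ^+ k) = mu ^+ k *: v by rewrite cmxX (mulmx_pow_eigen _ _ _ _ _ k vA).
  have lc0 : 0 <= lam%:C%C :> R[i]%C by rewrite ler0c ltW.
  have := leB _ _ vB vN0; rewrite -lamk normrX rmorphXn ler_pXn2r ?nnegrE //.
  rewrite le_eqVlt => /orP[/eqP e|//].
  (* If [|mu| = lam], then [v] is a multiple of [y], which forces [mu = lam]. *)
  have [|d hd] := uniqB _ _ vB; first by rewrite normrX e -lamk rmorphXn.
  case/negP: muN; apply/eqP.
  have : mu *: v = lam%:C%C *: v.
    by rewrite -vA hd -scalemxAl -map_mxM yA map_mxZ !scalerA mulrC.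
  move/eqP; rewrite -subr_eq0 -scalerBl scaler_eq0 (negbTE vN0) orbF subr_eq0.
  by move/eqP.
exists lam; split=> //.
- split.
    rewrite -eigenvalue_root_char; apply/eigenvalueP; exists y => //.
    by apply: contraNneq y0 => ->; rewrite mxE.
  pose y' := ((y *m x) 0 0)^-1 *: y.
  have y'x : (y' *m x) 0 0 = 1.
    by rewrite -scalemxAl mxE mulVf // gt_eqF.
  have defl := char_poly_deflation _ _ _ _ y' _ Ax y'x.
  (* A double root [lam] of [char_poly A] would be a root of the deflated polynomial. Its left
     eigenvector [v] satisfies [v x = 0], so it is also one of [A] and a multiple of [y]; but
     [y x > 0]. *)
  apply/negP => dv.
  have : ('X - lam%:P) ^+ 2 %| 'X * char_poly A by rewrite dvdp_mull.
  rewrite defl expr2 dvdp_mul2l ?polyXsubC_eq0 // dvdp_XsubCl.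
  rewrite -eigenvalue_root_char => /eigenvalueP[v vN vN0].
  have vx : v *m x = 0.
    have : v *m (A - lam *: (x *m y')) *m x = 0.
      rewrite -mulmxA mulmxBl Ax -scalemxAl -mulmxA [y' *m x]mx11_scalar y'x.
      by rewrite mulmx1 subrr mulmx0.
    rewrite vN -scalemxAl => /eqP; rewrite scaler_eq0 gt_eqF //=.
    by move/eqP.
  have vA : v *m A = lam *: v.
    by rewrite -vN mulmxBr -scalemxAr mulmxA vx mul0mx scaler0 subr0.
  have [|d hd] := uniqB _ _ (cE _ _ k vA).
    by rewrite normc_real lamk nrho.
  have [b vE] := real_scale_factor _ _ _ _ _ _ _ _ y0 hd.
  move: vx vN0; rewrite vE -scalemxAl => /matrixP/(_ 0 0).
  rewrite mxE [RHS]mxE => /eqP; rewrite mulf_eq0 [X in _ || X]gt_eqF // orbF.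
  by move/eqP => ->; rewrite scale0r eqxx.
- move=> mu; rewrite /ceigenvalue -eigenvalue_root_char => /eigenvalueP[v vA vN0].
  exact: dom vA vN0.
- exists x, y^T; split=> //.
  + by rewrite -trmx_mul yA linearZ.
  + by move=> i; case: (hxy i).
  + by move=> i; rewrite mxE; case: (hxy i).
  + by move=> i; rewrite mxE; case: (hxy i).
Qed.

(** * From the signature equality property to eventually SJS powers *)

(** The relation [y N = 0] kills the cross terms. The exponent is [k.+1] because exponent 0 would
    give [1 = x y + 1]. *)
Lemma deflated_pow (R : comNzRingType) (n k : nat) (A : 'M[R]_n) (x : 'cV[R]_n)
    (y : 'rV[R]_n) (lam : R) :
  A *m x = lam *: x -> y *m A = lam *: y -> (y *m x) 0 0 = 1 ->
  A ^+ k.+1 = lam ^+ k.+1 *: (x *m y) + (A - lam *: (x *m y)) ^+ k.+1.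
Proof.
move=> Ax yA yx; set N := A - _.
have yN : y *m N = 0.
  rewrite mulmxBr yA -scalemxAr mulmxA [y *m x]mx11_scalar yx mul1mx.
  by rewrite subrr.
elim: k => [|k IHk]; first by rewrite !expr1 addrC subrK.
rewrite exprS IHk mulrDr -[A * (_ *: _)]/(A *m (_ *: _)) -scalemxAr mulmxA Ax.
rewrite -scalemxAl scalerA -exprSr; congr (_ + _).
have PN : (lam *: (x *m y)) *m N ^+ k.+1 = 0.
  rewrite -scalemxAl -mulmxA [N ^+ k.+1]exprS [y *m _]mulmxA yN mul0mx mulmx0.
  exact: scaler0.
have -> : A = N + lam *: (x *m y) by rewrite subrK.
by rewrite mulrDl -exprS -[RHS]addr0; congr (_ + _).
Qed.

Lemma signature_equality_eventually_SJS (R : realType) (n : nat) (A : 'M[R]_n.+1) :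
  signature_equality A ->
  exists k0 : nat, (0 < k0)%N /\ forall k : nat, (k0 <= k)%N -> SJS (A ^+ k).
Proof.
move=> [lam [lam0 [_ simp] dom [x [y [Ax ATy xN0 _ sxy]]]]].
have yxp : 0 < (y^T *m x) 0 0 by apply: same_sign_dot_gt0 => // i; rewrite mxE.
set d := (y^T *m x) 0 0 in yxp.
pose y' := d^-1 *: y^T.
have y'x : (y' *m x) 0 0 = 1 by rewrite -scalemxAl mxE mulVf // gt_eqF.
have y'A : y' *m A = lam *: y'.
  have yA : y^T *m A = lam *: y^T by rewrite -[A]trmxK -trmx_mul ATy linearZ.
  by rewrite -scalemxAl yA !scalerA mulrC.
have sy' i : Num.sg (y' 0 i) = Num.sg (x i 0).
  by rewrite !mxE sgrM gtr0_sg ?invr_gt0 // mul1r sxy.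
pose N := A - lam *: (x *m y').
have defl := char_poly_deflation _ _ _ _ y' _ Ax y'x; rewrite -/N in defl.
(* Otherwise [('X - lam) ^+ 2] divides ['X * char_poly A]; being coprime to ['X], since [lam] is
   nonzero, it would divide [char_poly A]. *)
have lamN : ~~ root (char_poly N) lam.
  apply: contra simp; rewrite -dvdp_XsubCl => dN.
  have : ('X - lam%:P) ^+ 2 %| 'X * char_poly A.
    by rewrite defl expr2 dvdp_mul2l ?polyXsubC_eq0.
  rewrite Gauss_dvdpr // coprimep_expl // coprimep_sym coprimep_XsubC.
  by rewrite rootX gt_eqF.
have domN (mu : R[i]%C) : root (char_poly (cmx N)) mu -> `|mu| < lam%:C%C.
  move=> rN.
  have := congr1 (map_poly (real_complex R)) defl.
  rewrite !rmorphM /= map_polyX rmorphB /= map_polyX map_polyC /= !map_char_poly => deflC.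
  have : root ('X * char_poly (cmx A)) mu by rewrite /cmx deflC rootM rN orbT.
  rewrite rootM rootX => /orP[/eqP ->|rA].
    by rewrite normr0 -[0]/(0%:C%C) ltcR.
  apply: dom rA _; apply: contraNneq lamN => muE.
  by move: rN; rewrite muE /cmx -(map_char_poly (real_complex R)) fmorph_root.
have [|mu rmu hmu] := max_modulus_root _ (char_poly (cmx N)).
  by rewrite size_char_poly.
have mulam := domN _ rmu.
(* The midpoint leaves room on both sides: [N ^+ k = O(r ^+ k)] and [r ^+ k = o(lam ^+ k)]. *)
pose r := (`|mu| + lam%:C%C) / 2.
have mur : `|mu| < r by rewrite midf_lt.
have rlam : r < lam%:C%C by rewrite midf_lt.
have r0 : 0 <= r by apply: le_trans (ltW mur).
have hr nu : root (char_poly (cmx N)) nu -> `|nu| < r.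
  by move=> /hmu hnu; apply: le_lt_trans mur.
have [c c0 hc] := mx_pow_bound _ _ _ _ hr.
have pN0 i j : x i 0 * y' 0 j != 0.
  by rewrite -sgr_eq0 sgrM sy' mulf_neq0 // sgr_eq0.
have ex (ij : 'I_n.+1 * 'I_n.+1) : exists k0 : nat, forall k, (k0 <= k)%N ->
    `|(N ^+ k) ij.1 ij.2| < lam ^+ k * `|x ij.1 0 * y' 0 ij.2|.
  case: ij => i j /=; set q := `|_ * _|.
  have q0 : 0 < q by rewrite normr_gt0.
  have qc0 : 0 < q%:C%C :> R[i]%C by rewrite -[0]/(0%:C%C) ltcR.
  have cq0 : 0 <= c / q%:C%C by rewrite divr_ge0 // ltW.
  have [k0 hk0] := expr_eventually_ltC _ _ _ _ cq0 r0 rlam.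
  exists k0 => k /hk0; rewrite mulrAC ltr_pdivrMr // -rmorphXn -rmorphM.
  move/(le_lt_trans (hc k i j)); rewrite -cmxX mxE normc_real.
  by rewrite ltcR.
have [K hK] := fin_all_exists ex.
(* The maximum makes the entrywise thresholds uniform; the successor makes [k] positive, as
   [deflated_pow] requires. *)
exists (\max_ij K ij).+1; split=> // k kK.
(* The leading term has the sign of [x_i y'_j], that is of [x_i x_j], so [J] collects the positive
   coordinates of [x]. *)
exists [set i | 0 < x i 0] => i j; rewrite !inE.
have := hK (i, j) k (leq_trans (leq_bigmax (i, j)) (ltnW kK)) => /=.
case: k kK => // k _; rewrite (deflated_pow _ _ _ _ _ _ _ Ax y'A y'x) -/N.
set e := (N ^+ _) i j; set l := lam ^+ k.+1.
have -> : (l *: (x *m y') + N ^+ k.+1) i j = l * (x i 0 * y' 0 j) + e.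
  by rewrite mxE; congr (_ + _); rewrite mxE [X in _ * X]mxE big_ord1.
set p := x i 0 * y' 0 j => lte.
have sp : Num.sg p = Num.sg (x i 0) * Num.sg (x j 0) by rewrite sgrM sy'.
have l0 : 0 < l by rewrite exprn_gt0.
have pos : 0 < p -> 0 < l * p + e.
  move=> p0; move: lte; rewrite (gtr0_norm p0) ltr_norml => /andP[h _].
  by rewrite -ltrBlDl sub0r.
have neg : p < 0 -> l * p + e < 0.
  move=> p0; move: lte; rewrite (ltr0_norm p0) ltr_norml => /andP[_ h].
  by rewrite mulrN in h; rewrite addrC -ltrBrDr sub0r.
have [xi|xi|xi] := ltgtP (x i 0) 0; last by move: (xN0 i); rewrite xi eqxx.
- have [xj|xj|xj] := ltgtP (x j 0) 0; last by move: (xN0 j); rewrite xj eqxx.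
  + by apply: pos; rewrite -sgr_gt0 sp !ltr0_sg // mulrNN mulr1.
  + by apply: neg; rewrite -sgr_lt0 sp ltr0_sg // gtr0_sg // mulr1 ltrN10.
- have [xj|xj|xj] := ltgtP (x j 0) 0; last by move: (xN0 j); rewrite xj eqxx.
  + by apply: neg; rewrite -sgr_lt0 sp gtr0_sg // ltr0_sg // mul1r ltrN10.
  + by apply: pos; rewrite -sgr_gt0 sp !gtr0_sg // mulr1.
Qed.

Theorem theorem3 (R : realType) (n : nat) (hn : (0 < n)%N) (A : 'M[R]_n) :
  [/\ (signature_equality A ->
         exists k0 : nat, (0 < k0)%N /\ forall k : nat, (k0 <= k)%N -> SJS (A ^+ k)),
      ((exists k0 : nat, (0 < k0)%N /\ forall k : nat, (k0 <= k)%N -> SJS (A ^+ k)) ->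
         exists k : nat, (0 < k)%N /\ SJS (A ^+ k) /\ SJS (A ^+ k.+1)) &
      ((exists k : nat, (0 < k)%N /\ SJS (A ^+ k) /\ SJS (A ^+ k.+1)) ->
         signature_equality A)].
Proof.
case: n hn A => // n _ A; split.
- exact: signature_equality_eventually_SJS.
- by move=> [k0 [k0p hk]]; exists k0; do !split=> //; apply: hk.
- by move=> [k [kp [hk hk1]]]; apply: (@SJS_pow_signature_equality _ _ k).
Qed.
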